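(* For every $\alpha\in(0,1)$, $\operatorname{ex}(\alpha)\leq \operatorname{ex}_T(\alpha)$.
   Context: For $p$ prime, $A \subseteq \mathbb{Z}/p\mathbb{Z}$ and $\lambda\in\mathbb{Z}$, let $A+\lambda\cdot A=\{a+\lambda a' : a,a'\in A\}$. Define $\operatorname{ex}(\mathbb{Z}/p\mathbb{Z},\lambda,\alpha)=\min\{|A+\lambda\cdot A|/p : A\subseteq\mathbb{Z}/p\mathbb{Z},\ |A|\geq \alpha p\}$, $\operatorname{ex}(\lambda,\alpha)=\limsup_{p\to\infty} \operatorname{ex}(\mathbb{Z}/p\mathbb{Z},\lambda,\alpha)$ (over primes $p$), and $\operatorname{ex}(\alpha)=\limsup_{\lambda\to\infty}\operatorname{ex}(\lambda,\alpha)$. Let $\mathbb{T}=\mathbb{R}/\mathbb{Z}$ and $\mu$ the Lebesgue (Haar) measure on $\mathbb{T}^k$ for each $k$. For an integer $n>1$, let $\pi_1:\mathbb{T}^n\to\mathbb{T}^{n-1}$ be the projection forgetting the first coordinate and $\pi_n:\mathbb{T}^n\to\mathbb{T}^{n-1}$ the projection forgetting the last coordinate. Define $\operatorname{ex}_T(n,\alpha)=\inf\{\mu(\pi_1(B)+\pi_n(B)) : B\subseteq\mathbb{T}^n \text{ open},\ \mu(B)>\alpha\}$ and $\operatorname{ex}_T(\alpha)=\lim_{n\to\infty}\operatorname{ex}_T(n,\alpha)$ (this limit exists since $\operatorname{ex}_T(n,\alpha)$ is non-increasing in $n$). *)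

(* Defs.v *)
From HB Require Import structures.
From mathcomp Require Import all_boot all_order all_algebra.
From mathcomp Require Import generic_quotient ring_quotient.
From mathcomp Require Import all_classical all_reals all_analysis.

Set Implicit Arguments.
Unset Strict Implicit.
Unset Printing Implicit Defensive.

Import Order.TTheory GRing.Theory Num.Theory.
Import numFieldNormedType.Exports.

Local Open Scope classical_set_scope.
Local Open Scope ring_scope.
Local Open Scope quotient_scope.

Section cyclic.
Context {R : realType}.
Implicit Types (p : nat) (lambda : int) (alpha : R).

Definition sum_dilate p lambda (A : {set 'F_p}) : {set 'F_p} :=
  [set a + a' *~ lambda | a in A, a' in A]%SET.

(* 'F_p is Z/pZ only for p prime; ex_dilate looks at no other p. The default
   value 1 of the minimum is the value at A = Z/pZ, which is a candidate for
   every alpha <= 1. *)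
Definition ex_mod p lambda alpha : R :=
  \big[Order.min/1]_(A : {set 'F_p} | alpha * p%:R <= #|A|%:R)
    (#|sum_dilate lambda A|%:R / p%:R).

Definition ex_dilate lambda alpha : \bar R :=
  limf_esup (fun p => (ex_mod p lambda alpha)%:E)
    (within [set p | prime p] \oo).

Definition ex_cyclic alpha : \bar R :=
  limn_esup (fun l : nat => ex_dilate l%:Z alpha).

End cyclic.

(* T = R/Z; int_num_subdef is the predicate underlying the qualifier Num.int. *)
Definition circle (R : realType) : Type :=
  Quotient.quot (GRing.ZmodClosed.clone R Num.int_num_subdef _).

HB.instance Definition _ (R : realType) := GRing.Zmodule.on (circle R).
HB.instance Definition _ (R : realType) := Quotient.on (circle R).

Section circle_topology.
Context {R : realType}.
Local Notation pi := (\pi_(circle R) : R -> circle R).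

(* This is quotient_open; copying quotient_topology would bring in another
   choiceType structure, in conflict with the zmodType one. *)
Definition circle_open (U : set (circle R)) := open (pi @^-1` U).

Let circle_openT : circle_open setT.
Proof. exact: openT. Qed.

Let circle_openI : setI_closed circle_open.
Proof. by move=> U V; exact: openI. Qed.

Let circle_open_bigcup (I : Type) (U : I -> set (circle R)) :
  (forall i, circle_open (U i)) -> circle_open (\bigcup_i U i).
Proof. by move=> oU; apply: bigcup_open => i _; exact: oU. Qed.

HB.instance Definition _ := isOpenTopological.Build (circle R)
  circle_openT circle_openI circle_open_bigcup.

End circle_topology.

Section torus.
Context {R : realType}.

(* Lebesgue measure on R^n, as an iterated product measure *)
Fixpoint lebesgue_tuple n : set (n.-tuple R) -> \bar R :=
  match n with
  | 0 => \d_[tuple]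
  | m.+1 => pushforward (lebesgue_measure \x @lebesgue_tuple m)%E
              (fun xt => [tuple of xt.1 :: xt.2])
  end.

(* The Haar measure of B is the Lebesgue measure of its lift to the
   fundamental domain [0, 1)^n. *)
Definition haar n (B : set 'rV[circle R]_n) : \bar R :=
  lebesgue_tuple [set t : n.-tuple R | (forall i, 0 <= tnth t i < 1) /\
    B (\row_i \pi_(circle R) (tnth t i))].

(* n.-1.+1 is n for n > 0. The maps col' ord0 and col' ord_max forget the first
   and the last coordinate. *)
Definition ex_torus (n : nat) (alpha : R) : \bar R :=
  ereal_inf
    [set haar [set x + y | x in col' ord0 @` B & y in col' ord_max @` B]
      | B in [set B : set 'rV[circle R]_n.-1.+1 |
               open B /\ (alpha%:E < haar B)%E]].

Definition ex_torus_lim (alpha : R) : \bar R :=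
  limn (fun n => ex_torus n alpha).

End torus.

(* Main.v *)
From HB Require Import structures.
Require Import Defs.
From mathcomp Require Import all_boot all_order all_algebra.
From mathcomp Require Import generic_quotient ring_quotient.
From mathcomp Require Import all_classical all_reals all_analysis.
From mathcomp Require Import zify ring lra.

(* Cut T^n into half-open cubes of side 1/N. For an open B with mu(B) > alpha and
   N a large power of 2, the cubes contained in B have total measure > alpha.
   Let A be the set of x in Z/pZ such that (x, lambda x, ..., lambda^(n-1) x) / p
   lies in one of these cubes, and let psi(z) = (z, lambda z, ..., lambda^(n-2) z) / p.
   Then psi(a + lambda a') is the sum of the point of a without its last coordinate
   and the point of a' without its first one, so psi maps A + lambda A into cubes
   contained in pi_1(B) + pi_n(B). When p and then lambda tend to infinity, each cube
   receives a proportion of Z/pZ which is at least its volume up to an arbitrarily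
   small error. Counting in the cubes bounds |A| from below, and counting in the
   complementary cubes bounds |A + lambda A| from above. *)

Set Implicit Arguments.
Unset Strict Implicit.
Unset Printing Implicit Defensive.

Import Order.TTheory GRing.Theory Num.Theory.
Import numFieldNormedType.Exports.

(** * Counting residues with prescribed digits *)

Local Open Scope nat_scope.

(* An integer m = floor (x * N * lam ^ n / p) determines the cube of side 1/N that
   contains (x, lam x, ..., lam ^ (n-1) x) / p mod 1, through the digits below. *)
Lemma leq_card_digits (N lam n : nat) (c : nat -> nat) : 0 < N -> 0 < lam ->
    (forall k, c k < N) ->
  N * (lam %/ N - 1) ^ n <=
  #|[set m : 'I_(N * lam ^ n) |
     [forall k : 'I_n, (m %/ lam ^ (n - k)) %% N == c k]]%SET|.
Proof.
move=> N0 l0; elim: n c => [|n IH] c cN.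
  rewrite [leqLHS]muln1 -[leqLHS](_ : #|'I_(N * lam ^ 0)| = N); last first.
    by rewrite card_ord muln1.
  apply: subset_leq_card; apply/fintype.subsetP => m _; rewrite inE.
  by apply/forallP => -[].
set b := (lam %/ N - 1).
rewrite expnS mulnCA.
have {IH} /(leq_mul (leqnn b)) IH := IH (fun k => c k.+1) (fun k => cN _).
apply: leq_trans IH _.
rewrite -/b; set S := finset _; set T := finset _.
rewrite -[leqLHS](congr1 (muln^~ _) (card_ord b)) -cardsT -cardsX.
(* Write [m = q * (N * lam ^ n) + r] with [r < N * lam ^ n]. The leading digit of m is [c 0] as soon
   as [q, q + 1] lies between [c 0 * lam / N] and [(c 0 + 1) * lam / N], which leaves at least [b]
   values of q. The other digits of m are those of r. *)
pose q (j : nat) := c 0 * lam %/ N + 1 + j.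
have qN j : c 0 * lam <= q j * N.
  rewrite /q; have := ltn_ceil (c 0 * lam) N0; nia.
have qN1 (j : 'I_b) : (q j + 1) * N <= (c 0 + 1) * lam.
  have := ltn_ord j; rewrite /b /q => jb.
  have := leq_trunc_div (c 0 * lam) N; have := leq_trunc_div lam N; nia.
have fP (jr : 'I_b * 'I_(N * lam ^ n)) :
    q jr.1 * (N * lam ^ n) + jr.2 < N * lam ^ n.+1.
  rewrite expnS; have aux a r L : (a + 1) * N <= (c 0 + 1) * lam ->
      r < N * L -> a * (N * L) + r < N * (lam * L) by have := cN 0; nia.
  exact: aux (qN1 _) (ltn_ord _).
pose f jr := Ordinal (fP jr).
have finj : injective f.
  move=> [j r] [j' r'] /(congr1 val) /= E.
  have d0 : 0 < N * lam ^ n by rewrite muln_gt0 N0 expn_gt0 l0.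
  have := congr1 (divn^~ (N * lam ^ n)) E.
  have := congr1 (modn^~ (N * lam ^ n)) E.
  rewrite /= !modnMDl !modn_small // !divnMDl // !divn_small // !addn0.
  by move=> /ord_inj -> /addnI/ord_inj ->.
rewrite -(card_imset _ finj); apply: subset_leq_card.
apply/fintype.subsetP => _ /imsetP[[j r] jrS ->].
move: jrS; rewrite !inE => /andP[_ rS]; apply/forallP => -[[|k] kn] /=.
  rewrite subn0 (_ : _ %/ _ = c 0) ?modn_small ?cN//.
  apply/eqP; rewrite eqn_leq -ltnS ltn_divLR ?expn_gt0 ?l0// leq_divRL ?expn_gt0 ?l0//.
  have aux a r' L : c 0 * lam <= a * N -> (a + 1) * N <= (c 0 + 1) * lam ->
      r' < N * L -> (a * (N * L) + r' < (c 0).+1 * (lam * L)) &&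
      (c 0 * (lam * L) <= a * (N * L) + r') by nia.
  rewrite expnS; exact: aux (qN j) (qN1 j) (ltn_ord _).
rewrite subSS; have nk : lam ^ n = lam ^ k * lam ^ (n - k).
  by rewrite -expnD subnKC// ltnW.
have aux a r' : (a * (N * lam ^ n) + r') %/ lam ^ (n - k) %% N =
    r' %/ lam ^ (n - k) %% N.
  rewrite nk [N * _]mulnA mulnA divnMDl ?expn_gt0 ?l0//.
  by rewrite [N * _]mulnC mulnA modnMDl.
rewrite aux.
by move/forallP : rS => /(_ (Ordinal (kn : k < n))).
Qed.

Lemma divn_modn_mulr (N p a : nat) : 0 < p -> (N * (a %% p)) %/ p = (N * a %/ p) %% N.
Proof.
move=> p0; case: (posnP N) => [->|N0]; first by rewrite !mul0n div0n mod0n.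
rewrite {2}(divn_eq a p) mulnDr mulnA divnMDl// [N * (_ %/ _)]mulnC modnMDl.
rewrite [RHS]modn_small//.
by rewrite ltn_divLR// ltn_pmul2l// ltn_pmod.
Qed.

(** Put [L = N * lam ^ n]. For each [m < L], the x with floor (x L / p) = m are the integers of a
    half-open interval of length p / L, so there are at least [p %/ L] of them. Their digits are
    those of m, because [N * x * lam ^ k] is [x * L] divided by [lam ^ (n - k)]. *)
Lemma leq_card_orbit (N lam n p : nat) (c : nat -> nat) : 0 < N -> 0 < lam ->
    (forall k, c k < N) ->
  N * (lam %/ N - 1) ^ n * (p %/ (N * lam ^ n)) <=
  #|[set x : 'I_p | [forall k : 'I_n, (N * (x * lam ^ k %% p)) %/ p == c k]]%SET|.
Proof.
move=> N0 l0 cN; have := leq_card_digits n N0 l0 cN.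
set S := finset _; set T := finset _; set L := N * lam ^ n => cS.
have L0 : 0 < L by rewrite muln_gt0 N0 expn_gt0 l0.
apply: (@leq_trans (#|S| * (p %/ L))); first by rewrite leq_mul2r cS orbT.
rewrite -[X in _ * X]card_ord -cardsT -cardsX.
(* The ceiling of m p / L, that is, the least x of the interval attached to m. *)
pose q (m : nat) := (m * p + L - 1) %/ L.
have q1 m : m * p <= q m * L.
  rewrite /q; have := ltn_ceil (m * p + L - 1) L0; nia.
have q2 m (j : 'I_(p %/ L)) : (q m + j) * L < (m + 1) * p.
  have := leq_trunc_div (m * p + L - 1) L; have := leq_trunc_div p L.
  by rewrite -/(q m); have := ltn_ord j; nia.
have fP (mj : 'I_L * 'I_(p %/ L)) : q mj.1 + mj.2 < p.
  by have := q2 mj.1 mj.2; have := ltn_ord mj.1; nia.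
pose f jr := Ordinal (fP jr).
have fm mj : f mj * L %/ p = mj.1.
  have := ltn_ord mj.1 => ?.
  have p0 : 0 < p by apply: leq_ltn_trans (fP mj).
  apply/eqP; rewrite eqn_leq -ltnS ltn_divLR// leq_divRL//.
  by have := q1 mj.1; have := q2 mj.1 mj.2; rewrite /=; nia.
have finj : injective f.
  move=> [m j] [m' j'] E; have := fm (m', j'); rewrite -E fm /= => /ord_inj mm.
  by move: (congr1 val E); rewrite /= mm => /addnI/ord_inj ->.
rewrite -(card_imset _ finj); apply: subset_leq_card.
apply/fintype.subsetP => _ /imsetP[[m j] mjS ->].
move: mjS; rewrite !inE => /andP[/forallP/= mS _]; apply/forallP => k.
have p0 : 0 < p by apply: leq_ltn_trans (fP (m, j)).
move: mS => /(_ k)/eqP <-; apply/eqP.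
rewrite divn_modn_mulr// -[X in _ = X %/ _ %% _](fm (m, j)) divnAC.
congr (_ %/ _ %% _).
have nk x : x * L %/ lam ^ (n - k) = N * (x * lam ^ k).
  have -> : L = N * lam ^ k * lam ^ (n - k).
    by rewrite -mulnA -expnD subnKC// ltnW.
  by rewrite mulnA mulnK ?expn_gt0 ?l0// mulnCA mulnA.
by rewrite nk.
Qed.

(** * Asymptotics of the count *)

Local Open Scope classical_set_scope.
Local Open Scope ring_scope.

(** Without the roundings the count would be p / N^n. Rounding lam / N costs a factor that tends to
    1 as lam grows, which uses up one half of e; rounding p / L uses up the other half once p is
    large in terms of lam. *)
Lemma orbit_density (R : realType) (N n : nat) (e : R) : (0 < N)%N -> 0 < e ->
  exists lam0, forall lam, (lam0 <= lam)%N -> exists p0, forall p, (p0 <= p)%N ->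
  ((N%:R ^+ n)^-1 - e) * p%:R <=
    (N * (lam %/ N - 1) ^ n * (p %/ (N * lam ^ n)))%:R.
Proof.
move=> N0 e0; have NR : 0 < N%:R :> R by rewrite ltr0n.
have e2 : 0 < e / 2 by rewrite divr_gt0.
have lim1 : (N%:R^-1 - 2 * (@harmonic R lam)) @[lam --> \oo] --> (N%:R^-1 : R).
  rewrite -[X in _ --> X]subr0; apply: cvgB; first exact: cvg_cst.
  by rewrite -(mulr0 (2 : R)); apply: cvgM; [exact: cvg_cst|exact: cvg_harmonic].
have /cvgrPdist_lt/(_ _ e2)[l0 _ l0P] := cvg_comp _ _ lim1 (@exprn_continuous R n _).
(* [harmonic lam] is 1 / (lam + 1), hence the shift of lam. The bound 2 N makes 1 / N - 2 / lam
   nonnegative, so that n-th powers can be compared through their bases. *)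
exists (maxn l0 (2 * N)).+1 => -[//|lam]; rewrite ltnS geq_max => /andP[/l0P /= h lN].
set L := (N * lam.+1 ^ n)%N.
have L0 : 0 < L%:R :> R by rewrite ltr0n /L muln_gt0 N0 expn_gt0.
have lR : 0 < lam.+1%:R :> R by rewrite ltr0n.
pose p0 := Num.truncn (2 * L%:R / e) .
exists p0.+1 => p pp0.
have {pp0} pL : L%:R <= e / 2 * p%:R.
  have : 2 * L%:R / e <= p%:R.
    by rewrite ltW// (lt_le_trans (truncnS_gt _))// ler_nat.
  rewrite ler_pdivrMr//; lra.
set M := (N * (lam.+1 %/ N - 1) ^ n)%N.
have ML : (N%:R ^+ n)^-1 - e / 2 <= M%:R / L%:R.
  apply: (@le_trans _ _ ((N%:R^-1 - 2 * lam.+1%:R^-1) ^+ n)).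
    by move: h; rewrite exprVn ltr_norml => /andP[_]; lra.
  rewrite /M /L !natrM !natrX -mulf_div divff ?gt_eqF// mul1r -expr_div_n.
  have NlR : 2 * N%:R <= lam.+1%:R :> R by rewrite -natrM ler_nat leqW.
  apply: lerXn2r; rewrite ?nnegrE.
  - by rewrite subr_ge0 ler_pdivrMr// mulrC ler_pdivlMr.
  - by rewrite divr_ge0 // ltW.
  rewrite -(ler_pM2r lR) mulrBl divfK ?gt_eqF// -mulrA mulVf ?gt_eqF// mulr1.
  have : lam.+1%:R < ((lam.+1 %/ N).+1)%:R * N%:R :> R.
    by rewrite -natrM ltr_nat ltn_ceil.
  rewrite -ltr_pdivrMr// [_ / _]mulrC => H1.
  have : (lam.+1 %/ N).+1%:R <= 2 + (lam.+1 %/ N - 1)%:R :> R.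
    by rewrite -natrD ler_nat; lia.
  by move: H1; lra.
have Mle : M%:R <= L%:R :> R.
  rewrite ler_nat /M /L leq_mul2l; case: (n) => [|k]; rewrite ?orbT// leq_exp2r//.
  by rewrite (leq_trans (leq_subr _ _) (leq_div _ _)) orbT.
have : p%:R < (p %/ L).+1%:R * L%:R :> R.
  by rewrite -natrM ltr_nat ltn_ceil// /L muln_gt0 N0 expn_gt0.
rewrite -ltr_pdivrMr// -natr1 => H1.
rewrite natrM.
have := ler_wpM2r (ler0n R p) ML.
have := ler_wpM2l (ler0n R M) (ltW H1).
rewrite mulrDr mulr1 !mulrBl.
have -> : M%:R * (p%:R / L%:R) = M%:R / L%:R * p%:R :> R by ring.
lra.
Qed.

(** * Digits of residues and the resulting bound on [ex_mod] *)

Section digits.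
Variables (N : nat) (N_gt0 : (0 < N)%N) (p : nat).
Local Notation P := (Zp_trunc (pdiv p)).+2.

Lemma digit_subproof (y : 'F_p) : (N * y %/ P < N)%N.
Proof. by rewrite ltn_divLR// ltn_pmul2l. Qed.

(** The index of the arc of length 1 / N that contains y / P mod 1. [P] is the modulus built into
    ['F_p]; it equals p for p prime. *)
Definition digit (y : 'F_p) : 'I_N := Ordinal (digit_subproof y).

(** The bit is the carry produced by the fractional parts of N y / P and N z / P. *)
Lemma digitD (y z : 'F_p) :
  exists e : bool, digit (y + z) = ((digit y + digit z + e) %% N)%N :> nat.
Proof.
exists (P <= (N * y) %% P + (N * z) %% P)%N.
by rewrite /= divn_modn_mulr// mulnDr divnD.
Qed.

(* The cube of side 1/N that contains (x, lam x, ..., lam ^ (n-1) x) / p mod 1. *)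
Definition digits n lam (x : 'F_p) : {ffun 'I_n -> 'I_N} :=
  [ffun k : 'I_n => digit (x *+ (lam ^ k)%N)].

Lemma leq_card_digits_eq n lam (c : {ffun 'I_n -> 'I_N}) : prime p -> (0 < lam)%N ->
  (N * (lam %/ N - 1) ^ n * (p %/ (N * lam ^ n)) <=
   #|[set x | digits n lam x == c]%SET|)%N.
Proof.
move=> pp l0; pose c' k := if insub k is Some i then c i : nat else 0%N.
have c'N k : (c' k < N)%N by rewrite /c'; case: insubP.
have := @leq_card_orbit N lam n P c' N_gt0 l0 c'N.
rewrite [in X in (X <= _)%N](Fp_cast pp) => /leq_trans; apply.
apply: subset_leq_card; apply/fintype.subsetP => x; rewrite !inE => /forallP h.
apply/eqP/ffunP => k; apply/val_inj; have /eqP := h k.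
by rewrite ffunE /= Zp_mulrn /= /c' valK => ->.
Qed.

Lemma leq_card_digits_in n lam (G : {set {ffun 'I_n -> 'I_N}}) :
  prime p -> (0 < lam)%N ->
  (#|G| * (N * (lam %/ N - 1) ^ n * (p %/ (N * lam ^ n))) <=
   #|[set x | digits n lam x \in G]%SET|)%N.
Proof.
move=> pp l0; rewrite -[X in (_ <= X)%N]sum1_card.
rewrite (partition_big (digits n lam) (mem G)) /=; last by move=> x; rewrite inE.
rewrite -sum_nat_const; apply: leq_sum => c cG.
apply: leq_trans (leq_card_digits_eq c pp l0) _.
rewrite sum1dep_card; apply: subset_leq_card; apply/fintype.subsetP => x.
by rewrite !inE => /eqP dx; rewrite dx cG eqxx.
Qed.

End digits.

(** The set A of residues with digits in [G] is large enough, and A + lam A has its digits in [H].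
    Since the counts are only lower bounds, they are applied to the complement of [H] to bound A +
    lam A from above. *)
Lemma ex_mod_le (R : realType) (N n : nat) (G : {set {ffun 'I_n.+1 -> 'I_N}})
    (H : {set {ffun 'I_n -> 'I_N}}) (alpha e : R) :
    (0 < N)%N -> 0 < e -> alpha * N%:R ^+ n.+1 < #|G|%:R ->
    (forall (c c' : {ffun 'I_n.+1 -> 'I_N}) (s : {ffun 'I_n -> 'I_N}),
      c \in G -> c' \in G ->
      (forall k, exists e : bool,
        s k = ((c (lift ord_max k) + c' (lift ord0 k) + e) %% N)%N :> nat) ->
      s \in H) ->
  exists lam0, forall lam, (lam0 <= lam)%N -> exists p0, forall p, (p0 <= p)%N ->
    prime p -> ex_mod p lam%:Z alpha <= #|H|%:R / N%:R ^+ n + e.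
Proof.
move=> N0 e0 aG GH.
have NR k : 0 < N%:R ^+ k :> R by rewrite exprn_gt0// ltr0n.
(* The slack in the hypothesis on [G], scaled so that [#|G| * e1 <= N ^ n.+1 * e1 = #|G| / N ^ n.+1
   - alpha]. *)
pose e1 := (#|G|%:R - alpha * N%:R ^+ n.+1) / (N%:R ^+ n.+1) ^+ 2.
have e1_0 : 0 < e1 by rewrite divr_gt0 ?subr_gt0// exprn_gt0.
(* The complement of [H] has at most [N ^ n] elements, so its total error is at most e. *)
pose e2 := e / N%:R ^+ n.
have e2_0 : 0 < e2 by rewrite divr_gt0.
have [l1 h1] := orbit_density n.+1 N0 e1_0.
have [l2 h2] := orbit_density n N0 e2_0.
exists (maxn l1 l2).+1 => -[//|lam]; rewrite ltnS geq_max => /andP[ll1 ll2].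
have {h1} [p1 h1] := h1 _ (leqW ll1); have {h2} [p2 h2] := h2 _ (leqW ll2).
exists (maxn p1 p2) => p; rewrite geq_max => /andP[/h1 {}h1 /h2 {}h2] pp.
have pR : 0 < p%:R :> R by rewrite ltr0n prime_gt0.
pose A := [set x : 'F_p | digits N0 n.+1 lam.+1 x \in G]%SET.
have cA : alpha * p%:R <= #|A|%:R.
  have := leq_card_digits_in N0 G pp (ltn0Sn lam); rewrite -/A -(ler_nat R) natrM.
  apply: le_trans; apply: le_trans (ler_wpM2l (ler0n _ _) h1).
  rewrite mulrA ler_pM2r//.
  have GN : #|G|%:R <= N%:R ^+ n.+1 :> R.
    rewrite -natrX ler_nat (leq_trans (max_card _))//.
    by rewrite card_ffun !card_ord.
  have : #|G|%:R * e1 <= N%:R ^+ n.+1 * e1 by rewrite ler_wpM2r// ltW.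
  rewrite [X in _ <= X](_ : _ = #|G|%:R / N%:R ^+ n.+1 - alpha); last first.
    by rewrite /e1; field; rewrite gt_eqF.
  by rewrite mulrBr; lra.
have sA : sum_dilate lam.+1%:Z A \subset [set x | digits N0 n lam.+1 x \in H]%SET.
  apply/fintype.subsetP => _ /imset2P[a a' aA a'A ->].
  rewrite inE; move: aA a'A; rewrite !inE => aA a'A.
  apply: (GH _ _ _ aA a'A) => k; rewrite !ffunE mulrnDl -pmulrn -mulrnA.
  have [b ->] := digitD N0 (a *+ (lam.+1 ^ k)%N) (a' *+ (lam.+1 * lam.+1 ^ k)%N).
  by exists b; rewrite lift_max lift0 expnS.
have cS : #|sum_dilate lam.+1%:Z A|%:R / p%:R <= #|H|%:R / N%:R ^+ n + e.
  rewrite ler_pdivrMr//.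
  pose X := [set x : 'F_p | digits N0 n lam.+1 x \in H]%SET.
  have sX : #|sum_dilate lam.+1%:Z A|%:R <= #|X|%:R :> R.
    by rewrite ler_nat subset_leq_card.
  have XC : #|X|%:R + #|~: X|%:R = p%:R :> R by rewrite -natrD cardsC card_Fp.
  have HC : #|H|%:R + #|~: H|%:R = N%:R ^+ n :> R.
    by rewrite -natrD cardsC card_ffun !card_ord natrX.
  have XH : #|~: H|%:R * ((N%:R ^+ n)^-1 - e2) * p%:R <= #|~: X|%:R :> R.
    rewrite -mulrA; apply: le_trans (ler_wpM2l (ler0n _ _) h2) _.
    rewrite -natrM ler_nat (leq_trans (leq_card_digits_in N0 _ pp (ltn0Sn lam)))//.
    by apply: subset_leq_card; apply/fintype.subsetP => x; rewrite !inE.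
  have He : #|~: H|%:R * e2 * p%:R <= e * p%:R.
    rewrite ler_pM2r// -[leRHS](_ : N%:R ^+ n * e2 = e); last first.
      by rewrite /e2 mulrC divfK// gt_eqF.
    by rewrite ler_wpM2r// -?HC ?lerDr// ltW.
  have HN : (#|H|%:R / N%:R ^+ n + #|~: H|%:R / N%:R ^+ n) * p%:R = p%:R :> R.
    by rewrite -mulrDl HC divff ?mul1r// gt_eqF.
  move: XH HN; rewrite mulrBr mulrBl !mulrDl; lra.
apply: le_trans cS; rewrite /ex_mod.
exact: bigmin_le_cond.
Qed.

(** * Lebesgue measure on tuples *)

Section monotone.
Local Open Scope ereal_scope.
Context {R : realType}.

(** The integral of a nonnegative function is a supremum over the simple functions below it. This
    yields monotonicity of [lebesgue_tuple] on arbitrary sets, among them lifts of sumsets. *)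
Lemma le_integral_ge0 d (T : measurableType d) (mu : {measure set T -> \bar R})
    (f g : T -> \bar R) :
    (forall x, 0 <= f x) -> (forall x, f x <= g x) ->
  \int[mu]_x f x <= \int[mu]_x g x.
Proof.
move=> f0 fg; rewrite !ge0_integralTE//; last by move=> x; apply: le_trans (fg x).
by apply: le_ereal_sup => _ [h hf <-]; exists h => // x; apply: le_trans (fg x).
Qed.

Lemma lebesgue_tuple_ge0 n (A : set (n.-tuple R)) : 0 <= lebesgue_tuple A.
Proof.
elim: n A => [|n IH] A /=; first exact: measure_ge0.
by apply: integral_ge0 => x _ /=; exact: IH.
Qed.

Lemma le_lebesgue_tuple n (A B : set (n.-tuple R)) :
  A `<=` B -> lebesgue_tuple A <= lebesgue_tuple B.
Proof.
elim: n A B => [|n IH] A B AB /=.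
  rewrite !diracE lee_fin ler_nat; case: (boolP (_ \in A)) => // /set_mem/AB.
  by move=> /mem_set ->.
apply: le_integral_ge0 => x /=; first exact: lebesgue_tuple_ge0.
by apply: IH => t; rewrite /xsection /= !inE; exact: AB.
Qed.

End monotone.

Section cons_measure.
Local Open Scope ereal_scope.
Context {R : realType} (n : nat).
Variable mu : {sigma_finite_measure set (n.-tuple R) -> \bar R}.
Let f (xt : R * n.-tuple R) := [tuple of xt.1 :: xt.2].

Let mf : measurable_fun setT f.
Proof. exact: measurable_cons. Qed.

HB.instance Definition _ := isMeasurableFun.Build _ _ _ _ f mf.

(** The recursion step of [lebesgue_tuple]. Sigma-finiteness is carried along so that the next
    product is again a measure. *)
Definition cons_measure := pushforward (lebesgue_measure \x mu) f.

Let cons_measure0 : cons_measure set0 = 0.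
Proof. exact: measure0. Qed.

Let cons_measure_ge0 A : 0 <= cons_measure A.
Proof. exact: measure_ge0. Qed.

Let cons_measure_sigma_additive : semi_sigma_additive cons_measure.
Proof. exact: measure_semi_sigma_additive. Qed.

HB.instance Definition _ := isMeasure.Build _ _ _ cons_measure
  cons_measure0 cons_measure_ge0 cons_measure_sigma_additive.

Let cons_measure_sigma_finite : sigma_finite setT cons_measure.
Proof.
pose L := @lebesgue_measure R.
have /sigma_finiteP[F [TF ndF Foo]] : sigma_finite setT L by exact: sigma_finiteT.
have /sigma_finiteP[G [TG ndG Goo]] := sigma_finiteT mu.
pose g (t : n.+1.-tuple R) : n.-tuple R := [tuple of behead t].
exists (fun k => [set t | F k (tnth t ord0)] `&` g @^-1` G k).
  apply/esym; rewrite -subTset => t _.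
  have [k _ Fk] : (\bigcup_i F i) (tnth t ord0) by rewrite -TF.
  have [l _ Gl] : (\bigcup_i G i) (g t) by rewrite -TG.
  exists (maxn k l) => //; split => /=.
    by move: Fk; exact/subsetPset/ndF/leq_maxl.
  by move: Gl; exact/subsetPset/ndG/leq_maxr.
move=> k; have [mF Fk] := Foo k; have [mG Gk] := Goo k; split.
  apply: measurableI.
    by rewrite -[X in measurable X]setTI; exact: measurable_tnth.
  by rewrite -[X in measurable X]setTI; exact: measurable_behead.
rewrite /cons_measure /pushforward (_ : _ @^-1` _ = F k `*` G k).
  by rewrite product_measure1E// lte_mul_pinfty// ge0_fin_numE.
apply/seteqP; split=> -[x t]; rewrite /= (_ : g _ = t)//; exact/val_inj.
Qed.

HB.instance Definition _ := Measure_isSigmaFinite.Build _ _ _ cons_measure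
  cons_measure_sigma_finite.

End cons_measure.

(** Gives the bare set function [lebesgue_tuple] access to additivity and continuity from below. *)
Lemma lebesgue_tuple_measure (R : realType) n :
  exists mu : {sigma_finite_measure set (n.-tuple R) -> \bar R},
    @lebesgue_tuple R n = mu.
Proof.
elim: n => [|n [mu IH]]; first by exists (\d_ [tuple]).
by exists (cons_measure mu); rewrite /= IH.
Qed.

(** * Half-open cubes of side 1 / N *)

Section cells.
Context {R : realType}.
Implicit Types (N n : nat).

Definition cell N n (c : {ffun 'I_n -> 'I_N}) : set (n.-tuple R) :=
  [set t | forall i, (c i)%:R / N%:R <= tnth t i < (c i).+1%:R / N%:R].

Lemma measurable_cell N n (c : {ffun 'I_n -> 'I_N}) : measurable (cell c).
Proof.
rewrite (_ : cell c = \bigcap_i ((fun t : n.-tuple R => tnth t i) @^-1`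
    `[((c i)%:R / N%:R : R), ((c i).+1%:R / N%:R)[)).
  apply: fin_bigcap_measurable => // i _.
  by rewrite -[X in measurable X]setTI; exact: measurable_tnth.
apply/seteqP; split=> t /= tc i; first by move=> _; rewrite /= in_itv /=; exact: tc.
by have := tc i I; rewrite /= in_itv.
Qed.

Lemma lebesgue_tuple_cell N n (c : {ffun 'I_n -> 'I_N}) : (0 < N)%N ->
  lebesgue_tuple (cell c) = ((N%:R ^+ n)^-1)%:E.
Proof.
move=> N0; elim: n c => [|n IH] c /=.
  by rewrite expr0 invr1 diracE mem_set// => -[].
have [mu muE] := lebesgue_tuple_measure R n.
rewrite /pushforward (_ : _ @^-1` _ =
    `[((c ord0)%:R / N%:R : R), (c ord0).+1%:R / N%:R[ `*`
    cell [ffun i => c (lift ord0 i)]); last first.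
  apply/seteqP; split=> -[x t] /=.
    move=> xt; split; first by rewrite in_itv; exact: (xt ord0).
    by move=> i; have := xt (lift ord0 i); rewrite tnthS ffunE.
  rewrite in_itv /= => -[x0 tc] i; case: (unliftP ord0 i) => [j|] -> //.
  by have := tc j; rewrite tnthS ffunE.
rewrite muE product_measure1E//; last exact: measurable_cell.
rewrite -muE IH /= lebesgue_measure_itv /= lte_fin.
rewrite ltr_pM2r ?invr_gt0 ?ltr0n// ltr_nat ltnSn -EFinB -EFinM.
by rewrite -mulrBl -natr1 addrAC subrr add0r mul1r exprS invfM.
Qed.

Lemma cell_inj N n (c c' : {ffun 'I_n -> 'I_N}) t :
  (0 < N)%N -> cell c t -> cell c' t -> c = c'.
Proof.
move=> N0 ct c't; apply/ffunP => i; apply/val_inj/eqP => /=.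
have NR : 0 < N%:R^-1 :> R by rewrite invr_gt0 ltr0n.
have /andP[h1 h2] := ct i; have /andP[h3 h4] := c't i.
have := le_lt_trans h1 h4; have := le_lt_trans h3 h2.
by rewrite !ltr_pM2r// !ltr_nat !ltnS eqn_leq => -> ->.
Qed.

Definition cells N n (G : {set {ffun 'I_n -> 'I_N}}) : set (n.-tuple R) :=
  \bigcup_(c in [set` G]) cell c.

Lemma measurable_cells N n (G : {set {ffun 'I_n -> 'I_N}}) : measurable (cells G).
Proof. by apply: fin_bigcup_measurable => // c _; exact: measurable_cell. Qed.

Lemma lebesgue_tuple_cells N n (G : {set {ffun 'I_n -> 'I_N}}) : (0 < N)%N ->
  lebesgue_tuple (cells G) = (#|G|%:R / N%:R ^+ n)%:E.
Proof.
move=> N0; have [mu muE] := lebesgue_tuple_measure R n.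
rewrite muE measure_fin_bigcup//; last 2 first.
- move=> c c' _ _ [t [ct c't]]; exact: cell_inj ct c't.
- by move=> c _; exact: measurable_cell.
rewrite (eq_fsbigr (fun=> ((N%:R ^+ n)^-1)%:E)); last first.
  by move=> c _; rewrite -(lebesgue_tuple_cell c N0) muE.
rewrite -(@bigfs _ _ _ _ (index_enum _) (mem G))//=; last 2 first.
- exact: index_enum_uniq.
- by move=> c _; rewrite mem_index_enum.
by rewrite sumEFin sumr_const mulr_natl.
Qed.

End cells.

(** * Approximation from inside by cubes *)

Section inner_cells.
Context {R : realType}.
Implicit Types (N n : nat).

Definition unit_cube n : set (n.-tuple R) :=
  [set t | forall i, 0 <= tnth t i < 1].

Lemma cell_unit_cube N n (c : {ffun 'I_n -> 'I_N}) : cell c `<=` @unit_cube n.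
Proof.
move=> t ct i; have /andP[c1 c2] := ct i.
have NR : 0 < N%:R :> R by rewrite ltr0n (leq_ltn_trans (leq0n _) (ltn_ord (c i))).
rewrite (le_trans _ c1) ?divr_ge0//= (lt_le_trans c2)//.
by rewrite ler_pdivrMr// mul1r ler_nat.
Qed.

Lemma unit_cube_cell N n (t : n.-tuple R) : (0 < N)%N -> unit_cube t ->
  exists c : {ffun 'I_n -> 'I_N}, cell c t.
Proof.
move=> N0 ut; have NR : 0 < N%:R :> R by rewrite ltr0n.
have cP i : (Num.truncn (tnth t i * N%:R) < N)%N.
  have /andP[t0 t1] := ut i.
  rewrite -(ltr_nat R); apply: le_lt_trans (_ : tnth t i * N%:R < _).
    by rewrite truncn_le mulr_ge0// ltW.
  by rewrite gtr_pMl.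
exists [ffun i => Ordinal (cP i)] => i; rewrite ffunE /=.
have /andP[t0 t1] := ut i.
rewrite ler_pdivrMr// ltr_pdivlMr//.
by apply: truncn_itv; rewrite mulr_ge0// ltW.
Qed.

Definition inner_cells N n (D : set (n.-tuple R)) : {set {ffun 'I_n -> 'I_N}} :=
  [set c | `[< cell c `<=` D >]]%SET.

Lemma inner_cellsP N n (D : set (n.-tuple R)) (c : {ffun 'I_n -> 'I_N}) :
  reflect (cell c `<=` D) (c \in inner_cells N D).
Proof. by rewrite inE; exact: asboolP. Qed.

Lemma cells_inner_cells N n (D : set (n.-tuple R)) :
  cells (inner_cells N D) `<=` D.
Proof. by move=> t [c /=] /inner_cellsP; apply. Qed.

(** The grid of side 1 / (k N) refines that of side 1 / N. Along powers of 2 the inner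
    approximations therefore increase. *)
Lemma cells_inner_cellsM n (D : set (n.-tuple R)) N k : (0 < N)%N -> (0 < k)%N ->
  (cells (inner_cells N D) : set (n.-tuple R)) `<=`
    cells (inner_cells (k * N) D).
Proof.
move=> N0 k0 t [c /= /inner_cellsP cD ct].
have kN0 : (0 < k * N)%N by rewrite muln_gt0 k0.
have [c' c't] := unit_cube_cell kN0 (cell_unit_cube ct).
exists c' => //=; apply/inner_cellsP => u c'u; apply: cD => i.
have NR : 0 < N%:R^-1 :> R by rewrite invr_gt0 ltr0n.
have kR : k%:R != 0 :> R by rewrite pnatr_eq0 -lt0n.
have kNR : 0 < (k * N)%:R^-1 :> R by rewrite invr_gt0 ltr0n.
have E m : m%:R / N%:R = (k * m)%:R / (k * N)%:R :> R.
  by rewrite !natrM -mulf_div divff// mul1r.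
have /andP[h1 h2] := ct i; have /andP[h3 h4] := c't i; have /andP[h5 h6] := c'u i.
move: (le_lt_trans h1 h4) (le_lt_trans h3 h2); rewrite !E !ltr_pM2r// !ltr_nat.
move=> a1 a2; apply/andP; split; [apply: le_trans h5|apply: lt_le_trans h6 _];
  by rewrite ler_pM2r// ler_nat; lia.
Qed.

Lemma cell_dist N n (c : {ffun 'I_n -> 'I_N}) (t u : n.-tuple R) i :
  cell c t -> cell c u -> `|tnth t i - tnth u i| < N%:R^-1.
Proof.
move=> /(_ i) + /(_ i); rewrite -natr1 mulrDl mul1r ltr_norml; lra.
Qed.

(** The second hypothesis is openness relative to the unit cube, for the sup distance: a cube of
    side less than d around t stays in [D]. *)
Lemma bigcup_cells_inner_cells n (D : set (n.-tuple R)) :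
  (forall t, D t -> unit_cube t) ->
  (forall t, D t -> exists2 d, 0 < d & forall u, unit_cube u ->
    (forall i, `|tnth u i - tnth t i| < d) -> D u) ->
  \bigcup_k cells (inner_cells (2 ^ k) D) = D.
Proof.
move=> Dcube Dopen; apply/seteqP; split=> t.
  by move=> [k _]; exact: cells_inner_cells.
move=> Dt; have [d d0 dP] := Dopen _ Dt.
pose k := (Num.truncn d^-1).+1.
have kd : (2 ^ k)%:R^-1 < d.
  rewrite invf_plt ?posrE ?ltr0n ?expn_gt0//.
  apply: lt_trans (truncnS_gt _) _.
  by rewrite ltr_nat ltn_expl.
exists k => //; have N0 : (0 < 2 ^ k)%N by rewrite expn_gt0.
have [c ct] := unit_cube_cell N0 (Dcube _ Dt).
exists c => //=; apply/inner_cellsP => u cu.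
by apply: dP (cell_unit_cube cu) _ => i; rewrite (lt_trans (cell_dist _ cu ct)).
Qed.

Lemma lt_card_inner_cells n (D : set (n.-tuple R)) (a : R) :
    (forall t, D t -> unit_cube t) ->
    (forall t, D t -> exists2 d, 0 < d & forall u, unit_cube u ->
      (forall i, `|tnth u i - tnth t i| < d) -> D u) ->
    (a%:E < lebesgue_tuple D)%E ->
  exists2 N, (0 < N)%N & a * N%:R ^+ n < #|inner_cells N D|%:R.
Proof.
move=> Dcube Dopen aD; have [mu muE] := lebesgue_tuple_measure R n.
pose C k : set (n.-tuple R) := cells (inner_cells (2 ^ k) D).
have mC k : measurable (C k) by exact: measurable_cells.
have muC : mu \o C @ \oo --> mu D.
  rewrite -(bigcup_cells_inner_cells Dcube Dopen).
  apply: nondecreasing_cvg_mu => //; first exact: bigcup_measurable.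
  apply/nondecreasing_seqP => k; apply/subsetPset; rewrite /C expnS.
  by apply: cells_inner_cellsM => //; rewrite expn_gt0.
have [k ak] : exists k, (a%:E < mu (C k))%E.
  apply: contrapT => /forallNP h.
  move: aD; rewrite muE -(cvg_lim _ muC)// ltNge => /negP; apply.
  apply: lime_le; first by apply/cvg_ex; exists (mu D).
  by apply: nearW => k /=; rewrite leNgt; apply/negP.
exists (2 ^ k)%N; first by rewrite expn_gt0.
move: ak; rewrite -muE lebesgue_tuple_cells ?expn_gt0// lte_fin.
by rewrite ltr_pdivlMr// exprn_gt0// ltr0n expn_gt0.
Qed.

End inner_cells.

Local Open Scope quotient_scope.

(** * Sumsets in the torus and the comparison with [ex_cyclic] *)

Section torus.
Context {R : realType}.
Local Notation pi := (\pi_(circle R) : R -> circle R).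

Lemma pi_circleD (x y : R) : pi (x + y) = pi x + pi y.
Proof. exact: Quotient.pi_add. Qed.

Lemma eq_pi_circle (x y : R) : (x - y \is a Num.int) -> pi x = pi y.
Proof. by move=> xy; apply/eqP; rewrite -Quotient.idealrBE. Qed.

Definition lift_set n (B : set 'rV[circle R]_n) : set (n.-tuple R) :=
  [set t | unit_cube t /\ B (\row_i pi (tnth t i))].

Lemma haarE n (B : set 'rV[circle R]_n) : haar B = lebesgue_tuple (lift_set B).
Proof. by []. Qed.

Lemma nbhs_pi_circle (x : R) (P : set (circle R)) :
  nbhs (pi x) P -> exists2 d, 0 < d & forall y, `|y - x| < d -> P (pi y).
Proof.
rewrite nbhsE => -[U [oU Ux] UP].
have : nbhs x (pi @^-1` U) by apply: open_nbhs_nbhs; split.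
move=> /nbhs_ballP[d d0 dU]; exists d => // y yx; apply: UP.
by apply: dU; rewrite /ball /= distrC.
Qed.

Lemma lift_set_open n (B : set 'rV[circle R]_n) (t : n.-tuple R) :
  open B -> lift_set B t -> exists2 d, 0 < d & forall u, unit_cube u ->
    (forall i, `|tnth u i - tnth t i| < d) -> lift_set B u.
Proof.
move=> oB [ut Bt]; have [P Pt PB] : nbhs (\row_i pi (tnth t i)) B.
  exact: open_nbhs_nbhs.
have /choice[d dP] : forall i, exists d, 0 < d /\
    forall y, `|y - tnth t i| < d -> P ord0 i (pi y).
  move=> i; have := Pt ord0 i; rewrite mxE => /nbhs_pi_circle[d d0 dP].
  by exists d.
(* The default value 1 keeps the radius positive when n = 0. *)
exists (\big[Order.min/1]_i d i).
  by apply/bigmin_gtP; split => // i _; have [] := dP i.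
move=> u uu ud; split => //; apply: PB => i j; rewrite mxE ord1.
have [_] := dP j; apply; apply: lt_le_trans (ud j) _; exact: bigmin_le.
Qed.

(* The excess of u over the corner of its cube is split evenly between the two
   summands. *)
Lemma cell_pi_add N (c c' s : nat) (e : bool) (u : R) : (0 < N)%N ->
    s = ((c + c' + e) %% N)%N -> s%:R / N%:R <= u < s.+1%:R / N%:R ->
  exists w, 0 <= w < 1 /\ pi u = pi ((c'%:R + w) / N%:R) + pi ((c%:R + w) / N%:R).
Proof.
move=> N0 sE /andP[u1 u2]; have NR : 0 < N%:R :> R by rewrite ltr0n.
move: u1 u2; rewrite ler_pdivrMr// ltr_pdivlMr// -natr1 => u1 u2.
(* The carry is split too: (c + c' + 2 w) / N exceeds u by the integer [(c + c' + e) %/ N]. *)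
exists ((e%:R + (u * N%:R - s%:R)) / 2); split.
  by case: (e); rewrite ?mulr0n ?mulr1n; lra.
rewrite -pi_circleD; apply: eq_pi_circle.
rewrite (_ : _ - _ = - ((c + c' + e) %/ N)%:R) ?rpredN ?rpred_nat//.
have : (c + c' + e)%:R = ((c + c' + e) %/ N)%:R * N%:R + s%:R :> R.
  by rewrite sE -natrM -natrD -divn_eq.
rewrite !natrD => E.
apply: (mulIf (lt0r_neq0 NR)); rewrite -mulrDl mulrBl divfK ?gt_eqF//.
rewrite mulNr; move: E; lra.
Qed.

Definition proj_sumset n (B : set 'rV[circle R]_n.+1) : set 'rV[circle R]_n :=
  [set x + y | x in col' ord0 @` B & y in col' ord_max @` B].

(** [h] is the coordinate that [col' h] forgets; it is placed at the corner of the cube. *)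
Lemma cell_lift_point N n (h : 'I_n.+1) (c : {ffun 'I_n.+1 -> 'I_N}) (w : 'I_n -> R) :
    (0 < N)%N -> (forall k, 0 <= w k < 1) ->
  exists2 t : n.+1.-tuple R, cell c t &
    forall k, tnth t (lift h k) = ((c (lift h k))%:R + w k) / N%:R.
Proof.
move=> N0 w01; have NR : 0 < N%:R^-1 :> R by rewrite invr_gt0 ltr0n.
exists [tuple ((c j)%:R + (if unlift h j is Some k then w k else 0)) / N%:R | j < n.+1].
  move=> j; rewrite tnth_mktuple ler_pM2r// ltr_pM2r// -natr1.
  by case: (unlift h j) => [k|]; [have := w01 k|]; lra.
by move=> k; rewrite tnth_mktuple liftK.
Qed.

(** The sum of two arcs of length 1 / N is an arc of length 2 / N, which covers the target arc for
    either carry. Hence the inner cubes of the sumset can serve as [H] in [ex_mod_le]. *)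
Lemma cell_col'_add N n (B : set 'rV[circle R]_n.+1)
    (c c' : {ffun 'I_n.+1 -> 'I_N}) (s : {ffun 'I_n -> 'I_N}) : (0 < N)%N ->
    cell c `<=` lift_set B -> cell c' `<=` lift_set B ->
    (forall k, exists e : bool,
      s k = ((c (lift ord_max k) + c' (lift ord0 k) + e) %% N)%N :> nat) ->
  cell s `<=` lift_set (proj_sumset B).
Proof.
move=> N0 cB c'B /choice[e se] u su; split; first exact: cell_unit_cube su.
have /choice[w wP] k := cell_pi_add N0 (se k) (su k).
have w01 k : 0 <= w k < 1 by have [] := wP k.
have [v /cB[_ Bv] vE] := cell_lift_point ord_max c N0 w01.
have [v' /c'B[_ Bv'] v'E] := cell_lift_point ord0 c' N0 w01.
exists (col' ord0 (\row_i pi (tnth v' i))); first by exists (\row_i pi (tnth v' i)).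
exists (col' ord_max (\row_i pi (tnth v i))); first by exists (\row_i pi (tnth v i)).
by apply/rowP => k; rewrite !mxE v'E vE; have [] := wP k.
Qed.

Lemma ex_cyclic_le_haar n (B : set 'rV[circle R]_n.+1) (alpha : R) :
    open B -> (alpha%:E < haar B)%E ->
  (ex_cyclic alpha <= haar (proj_sumset B))%E.
Proof.
move=> oB aB; set S := proj_sumset B.
have [N N0 aG] : exists2 N, (0 < N)%N &
    alpha * N%:R ^+ n.+1 < #|inner_cells N (lift_set B)|%:R.
  by apply: lt_card_inner_cells => // t []//; move=> ut Bt; exact: lift_set_open.
pose H := inner_cells N (lift_set S).
apply: le_trans (_ : (#|H|%:R / N%:R ^+ n)%:E <= _)%E; last first.
  rewrite -lebesgue_tuple_cells// haarE; apply: le_lebesgue_tuple.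
  exact: cells_inner_cells.
apply/lee_addgt0Pr => e e0; rewrite -EFinD.
have GH c c' (s : {ffun 'I_n -> 'I_N}) : c \in inner_cells N (lift_set B) ->
    c' \in inner_cells N (lift_set B) ->
    (forall k, exists e : bool,
      s k = ((c (lift ord_max k) + c' (lift ord0 k) + e) %% N)%N :> nat) ->
    s \in H.
  move=> /inner_cellsP cB /inner_cellsP c'B sP; apply/inner_cellsP.
  exact: cell_col'_add N0 cB c'B sP.
have [lam0 h] := ex_mod_le N0 e0 aG GH.
(* A limsup is an infimum of suprema over the sets of the filter, so one tail bounds it; this is
   done for lam, then for the primes p. *)
apply: ge_ereal_inf; exists (ereal_sup
  [set ex_dilate l%:Z alpha | l in [set l | (lam0 <= l)%N]]).
  by exists [set l | (lam0 <= l)%N] => //; exists lam0.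
apply: ge_ereal_sup => _ [l /= /h[p0 hp] <-].
apply: ge_ereal_inf; exists (ereal_sup
  [set (ex_mod p l%:Z alpha)%:E | p in [set p | (p0 <= p)%N /\ prime p]]).
  exists [set p | (p0 <= p)%N /\ prime p] => //.
  by exists p0 => // p /= p0p pp; split.
by apply: ge_ereal_sup => _ [p [p0p pp] <-]; rewrite lee_fin; exact: hp.
Qed.

(** * Monotonicity of [ex_torus] in n *)

Lemma haar_col'0_preimage n (B : set 'rV[circle R]_n) :
  haar [set v : 'rV[circle R]_n.+1 | B (col' ord0 v)] = haar B.
Proof.
rewrite [LHS]/haar /= /pushforward /product_measure1.
(* The section at x is the lift of [B] if x is in [0, 1) and empty otherwise. *)
rewrite (_ : _ \o _ = (cst (haar B)) \_ `[0, 1[); last first.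
  apply/funext => x; rewrite patchE /=.
  have col'E (t : n.-tuple R) : col' ord0 (\row_i pi (tnth [tuple of x :: t] i)) =
      \row_i pi (tnth t i).
    by apply/rowP => i; rewrite !mxE tnthS.
  case: ifPn => [/set_mem|/negP] x01.
    rewrite haarE; congr lebesgue_tuple; apply/seteqP; split => t;
      rewrite /xsection /= inE /= ?col'E.
      move=> [ut Bt]; split=> //.
      by move=> i; have := ut (lift ord0 i); rewrite tnthS.
    move=> [ut Bt]; split=> //.
    move=> i; case: (unliftP ord0 i) => [j|] ->; first by rewrite tnthS.
    by move: x01; rewrite /= in_itv.
  have [mu muE] := lebesgue_tuple_measure R n.
  rewrite (_ : xsection _ _ = set0) ?muE ?measure0//.
  rewrite -subset0 => t; rewrite /xsection /= inE => -[/= ut _]; apply: x01.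
  by rewrite inE /= in_itv; exact: (ut ord0).
rewrite -integral_mkcond integral_cst//= lebesgue_measure_itv/= lte_fin ltr01.
by rewrite sube0 mule1.
Qed.

(** The projections of T * B are B and T times the last projection of B; the factor T makes the
    first coordinate of a sum arbitrary. *)
Lemma proj_sumset_col'0_preimage n (B : set 'rV[circle R]_n.+1) :
  proj_sumset [set v : 'rV[circle R]_n.+2 | B (col' ord0 v)] =
  [set v | proj_sumset B (col' ord0 v)].
Proof.
have pullE (v : 'rV[circle R]_n.+1) : exists v', col' ord0 v' = v :> 'rV[circle R]_n.+1.
  exists (\row_i if unlift ord0 i is Some j then v ord0 j else 0).
  by apply/rowP => i; rewrite !mxE liftK.
apply/seteqP; split => z.
  move=> [_ [b Bb <-]] [_ [b' Bb' <-]] <-.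
  exists (col' ord0 (col' ord0 b)); first by exists (col' ord0 b).
  exists (col' ord_max (col' ord0 b')); first by exists (col' ord0 b').
  (* Forgetting the first and forgetting the last coordinate commute. *)
  apply/rowP => i; rewrite !mxE; congr (_ + b' _ _).
  by apply/val_inj; rewrite /= /bump; lia.
move=> [_ [b Bb <-]] [_ [b' Bb' <-]] /= bb'.
have [d dE] := pullE b.
exists b; first by exists d => //=; rewrite dE.
(* The free coordinate is chosen so that the sum starts with that of [z]. *)
pose d' : 'rV[circle R]_n.+2 :=
  \row_i if unlift ord0 i is Some j then b' ord0 j else z ord0 ord0 - b ord0 ord0.
exists (col' ord_max d').
  exists d' => //=; rewrite (_ : col' ord0 d' = b')//.
  by apply/rowP => i; rewrite !mxE liftK.
apply/rowP => i; rewrite !mxE; case: (unliftP ord0 i) => [j ->|->].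
  have -> : lift ord_max (lift ord0 j) = lift ord0 (lift ord_max j) :> 'I_n.+2.
    by apply/val_inj; rewrite /= /bump; lia.
  rewrite liftK; have /rowP/(_ j) := bb'; rewrite !mxE => <-; congr (_ + _).
rewrite (_ : lift _ _ = ord0); last by apply/val_inj; rewrite /= /bump; lia.
by rewrite unlift_none addrC subrK.
Qed.

(* B is replaced by T * B, for which proj_sumset is T * proj_sumset B; at n = 0 both
   sides are equal since ex_torus 0 is ex_torus 1. *)
Lemma ex_torus_nonincreasing (alpha : R) :
  nonincreasing_seq (fun n => ex_torus n alpha).
Proof.
apply/nonincreasing_seqP => -[|n]; first by [].
apply: le_ereal_inf_tmp => _ [B [oB aB] <-]; apply: ge_ereal_inf.
pose B' := [set v : 'rV[circle R]_n.+2 | B (col' ord0 v)].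
exists (haar (proj_sumset B')).
  exists B' => //; split; last by rewrite haar_col'0_preimage.
  rewrite openE => v /= Bv.
  have [P vP PB] : nbhs (col' ord0 v) B by exact: open_nbhs_nbhs.
  exists (fun i j => if unlift ord0 j is Some k then P i k else setT).
    move=> i j; case: unliftP => [k ->|_]; last exact: filterT.
    by have := vP i k; rewrite mxE.
  by move=> w wP; apply: PB => i j; have := wP i (lift ord0 j); rewrite liftK mxE.
by rewrite proj_sumset_col'0_preimage haar_col'0_preimage.
Qed.

Lemma ex_cyclic_le_torus n (alpha : R) : (ex_cyclic alpha <= ex_torus n alpha)%E.
Proof.
apply: le_ereal_inf_tmp => _ [B [oB aB] <-]; exact: ex_cyclic_le_haar.
Qed.

End torus.

Theorem theorem2p1 (R : realType) (alpha : R) (halpha : 0 < alpha < 1) :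
  (ex_cyclic alpha <= ex_torus_lim alpha)%E.
Proof.
apply: lime_ge; last by apply: nearW => n; exact: ex_cyclic_le_torus.
exact: ereal_nonincreasing_is_cvgn (ex_torus_nonincreasing alpha).
Qed.
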